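(* Let $m\in\mathbb{N}$, $\{l_1,\ldots,l_m\}\subset H'$, and define $\mathcal F:\ \mathbb{R}^n_+\to\mathbb{R}^{m\times m}$ by $$\mathcal F(\sigma)=(\mathcal F_{j,k}(\sigma))_{j,k=1,\ldots,m},\quad \mathcal F_{j,k}(\sigma):=l_k(u_\sigma^{l_j}).$$ Then $\mathcal F$ has the following properties: (a) $\mathcal F$ is infinitely often differentiable. (b) For all $\sigma\in\mathbb{R}^n_+$, $\mathcal F(\sigma)\in\mathbb{S}_m$ and $\mathcal F(\sigma)\succeq 0$. $\mathcal F(\sigma)$ is positive definite if $l_1,\ldots,l_m\in H'$ are linearly independent. (c) $\mathcal F$ is monotonically non-increasing, i.e. $$\mathcal F'(\sigma)\tau\preceq 0\quad\text{for all }\sigma\in\mathbb{R}^n_+,\ 0\le\tau\in\mathbb{R}^n,$$ and for all $\sigma^{(1)},\sigma^{(2)}\in\mathbb{R}^n_+$, $$\sigma^{(1)}\le\sigma^{(2)}\quad\text{implies}\quad\mathcal F(\sigma^{(1)})\succeq\mathcal F(\sigma^{(2)}).$$ (d) $\mathcal F$ is convex, i.e., for all $\sigma,\sigma^{(0)}\in\mathbb{R}^n_+$, $$\mathcal F(\sigma)-\mathcal F(\sigma^{(0)})\succeq\mathcal F'(\sigma^{(0)})(\sigma-\sigma^{(0)}),$$ and, for all $t\in[0,1]$, $$\mathcal F((1-t)\sigma^{(0)}+t\sigma)\preceq(1-t)\mathcal F(\sigma^{(0)})+t\,\mathcal F(\sigma).$$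
   Context: Setting: $H$ is a real Hilbert space and $H'=\mathcal L(H,\mathbb{R})$ is its dual. Let $n\in\mathbb{N}$ and let $b_0,b_1,\ldots,b_n:\ H\times H\to\mathbb{R}$ be bounded, symmetric and positive semidefinite bilinear forms. For $\sigma=(\sigma_1,\ldots,\sigma_n)\in\mathbb{R}^n$ set $$b_\sigma(u,v):=b_0(u,v)+\sum_{i=1}^n\sigma_i\, b_i(u,v).$$ With $\mathbf 1:=(1,\ldots,1)^T\in\mathbb{R}^n$, it is assumed that there are constants $\beta,C>0$ with $C\|v\|^2\ge b_{\mathbf 1}(v,v)\ge\beta\|v\|^2$ for all $v\in H$. $\mathbb{R}^n_+$ denotes the set of all $\sigma\in\mathbb{R}^n$ with all entries strictly positive; for such $\sigma$ the form $b_\sigma$ is symmetric, bounded and coercive, and for every $l\in H'$, $u_\sigma^l\in H$ denotes the unique solution of $b_\sigma(u_\sigma^l,v)=l(v)$ for all $v\in H$. Notation: ''$\le$'', ''$\ge$'' on $\mathbb{R}^n$ are elementwise. $\mathbb{S}_m\subseteq\mathbb{R}^{m\times m}$ is the set of symmetric $m\times m$ matrices, and $B\succeq A$ (equivalently $A\preceq B$) denotes the Loewner order, i.e. $B-A$ is positive semidefinite. $\mathcal F'(\sigma)\tau=\sum_{i=1}^n\tau_i\frac{\partial}{\partial\sigma_i}\mathcal F(\sigma)$ is the derivative of $\mathcal F$ at $\sigma$ in direction $\tau$. *)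

(* Defs.v *)
From HB Require Import structures.
From mathcomp Require Import all_boot all_order all_algebra.
From mathcomp Require Import all_classical all_reals all_analysis.

Set Implicit Arguments.
Unset Strict Implicit.
Unset Printing Implicit Defensive.

Import Order.TTheory GRing.Theory Num.Theory.
Import numFieldNormedType.Exports.

Local Open Scope classical_set_scope.
Local Open Scope ring_scope.

(* A real Hilbert space is a complete normed module H over R whose norm is the
   one of an inner product ip : {dot H for idfun}. *)
Definition norm_from_dot (R : realType) (H : completeNormedModType R)
    (ip : {dot H for (@idfun R)}) : Prop :=
  forall v : H, `|v| ^+ 2 = ip v v.

Definition bounded_form (R : realType) (H : normedModType R)
    (b : H -> H -> R) : Prop :=
  exists M : R, forall u v : H, `|b u v| <= M * `|u| * `|v|.

Definition possemidef_form (R : realType) (H : normedModType R)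
    (b : H -> H -> R) : Prop :=
  forall v : H, 0 <= b v v.

Definition lin_indep_forms (R : realType) (H : normedModType R) (m : nat)
    (l : 'I_m -> H -> R) : Prop :=
  forall c : 'I_m -> R,
    (forall v : H, \sum_(j < m) c j * l j v = 0) -> forall j, c j = 0.

Definition pos_orthant (R : realType) (n : nat) : set 'rV[R]_n :=
  [set s | forall i : 'I_n, 0 < s ord0 i].
Arguments pos_orthant : clear implicits.

Definition affine_form (R : realType) (H : normedModType R) (n : nat)
    (b0 : H -> H -> R) (b : 'I_n -> H -> H -> R) (s : 'rV[R]_n) : H -> H -> R :=
  fun u v => b0 u v + \sum_(i < n) s ord0 i * b i u v.

(* The solution u of a(u, v) = l(v) for all v; `get` returns an unspecified
   point only when there is no solution, which does not occur for a bounded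
   coercive a and a continuous l, where the solution is moreover unique. *)
Definition var_sol (R : realType) (H : normedModType R)
    (a : H -> H -> R) (l : H -> R) : H :=
  get [set u : H | forall v : H, a u v = l v].

(* Only the values on the positive orthant are meaningful. *)
Definition measurement_map (R : realType) (H : normedModType R) (n m : nat)
    (b0 : H -> H -> R) (b : 'I_n -> H -> H -> R) (l : 'I_m -> H -> R) :
    'rV[R]_n -> 'M[R]_m :=
  fun s => \matrix_(j < m, k < m) l k (var_sol (affine_form b0 b s) (l j)).

Definition possemidefmx (R : realType) (m : nat) (A : 'M[R]_m) : Prop :=
  A \is symmetricmx /\
  forall x : 'cV[R]_m, 0 <= (x^T *m A *m x) ord0 ord0.

Definition posdefmx (R : realType) (m : nat) (A : 'M[R]_m) : Prop :=
  A \is symmetricmx /\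
  forall x : 'cV[R]_m, x != 0 -> 0 < (x^T *m A *m x) ord0 ord0.

Definition loewner_le (R : realType) (m : nat) (A B : 'M[R]_m) : Prop :=
  possemidefmx (B - A).

Definition partial_deriv (R : realType) (n : nat) (W : normedModType R)
    (i : 'I_n) (f : 'rV[R]_n -> W) : 'rV[R]_n -> W :=
  fun x => 'D_(delta_mx ord0 i) f x.

Definition dir_deriv (R : realType) (n : nat) (W : normedModType R)
    (f : 'rV[R]_n -> W) (x v : 'rV[R]_n) : W :=
  \sum_(i < n) v ord0 i *: partial_deriv i f x.

(* k-fold Frechet differentiability on an open U: since the domain is R^n, the
   derivative x |-> Df(x) is identified with the tuple of partial derivatives
   of f, so that Df is k times differentiable iff all of these are. *)
Fixpoint ntimes_differentiable (R : realType) (n : nat) (W : normedModType R)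
    (k : nat) (U : set 'rV[R]_n) (f : 'rV[R]_n -> W) : Prop :=
  match k with
  | 0 => True
  | k'.+1 => (forall x, U x -> differentiable f x) /\
             forall i : 'I_n, ntimes_differentiable k' U (partial_deriv i f)
  end.

Definition smooth_on (R : realType) (n : nat) (W : normedModType R)
    (U : set 'rV[R]_n) (f : 'rV[R]_n -> W) : Prop :=
  forall k : nat, ntimes_differentiable k U f.

(* Main.v *)
(* The derivative formula behind everything is algebraic. Let T_p(s) map w to
   the solution of b_s(., v) = b_p(w, v) for all v. Comparing the equations at
   two points s and x gives the exact identity
     u_x = u_s - sum_p (x - s)_p T_p(s) u_x,
   and T_i(x) w satisfies the same identity. Since the coefficients (x - s)_p
   vanish at s, local boundedness of u implies its continuity at s, and its
   continuity implies differentiability with d_p u = - T_p u; iterating,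
   d_p (T_i g) = T_i (d_p g) - T_p T_i g, whence smoothness.
   For the order statements, put u_j := u_s^(l_j) and u0_j := u_s0^(l_j). Then
     F(s) - F(s0) - F'(s0)(s - s0) = (b_s(u_j - u0_j, u_k - u0_k))_(j, k),
     F(s) = (b_s(u_j, u_k))_(j, k),  - d_i F(s) = (b_i(u_j, u_k))_(j, k)
   are Gram matrices of positive semidefinite forms. Monotonicity and convexity
   of F both follow from these three facts. *)
Require Import Defs.
From HB Require Import structures.
From mathcomp Require Import all_boot all_order all_algebra.
From mathcomp Require Import all_classical all_reals all_analysis.
From mathcomp Require Import ring lra.

Set Implicit Arguments.
Unset Strict Implicit.
Unset Printing Implicit Defensive.

Import Order.TTheory GRing.Theory Num.Theory.
Import numFieldNormedType.Exports.

Local Open Scope classical_set_scope.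
Local Open Scope ring_scope.

(** * Symmetric forms and the Lax-Milgram theorem *)

Section SymmetricForms.
Variables (R : realType) (H : lmodType R) (a : {symmetric H}).
Implicit Types (u v w : H) (k : R).

Lemma symformC u v : a u v = a v u.
Proof. by rewrite (@hermitian_subproof _ _ _ _ a u v) expr0 mul1r. Qed.

Lemma symformDr u v w : a u (v + w) = a u v + a u w.
Proof. exact: linearDr. Qed.

Lemma symformNr u v : a u (- v) = - a u v.
Proof. exact: linearNr. Qed.

Lemma symformZr u k v : a u (k *: v) = k * a u v.
Proof. by rewrite linearZr_LR. Qed.

Lemma symformDl u v w : a (v + w) u = a v u + a w u.
Proof. exact: linearDl. Qed.

Lemma symformNl u v : a (- v) u = - a v u.
Proof. exact: linearNl. Qed.

Lemma symformZl u k v : a (k *: v) u = k * a v u.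
Proof. exact: linearZl_LR. Qed.

Lemma symform_suml (I : Type) (r : seq I) (P : pred I) (E : I -> H) v :
  a (\sum_(i <- r | P i) E i) v = \sum_(i <- r | P i) a (E i) v.
Proof. exact: linear_sumlz. Qed.

Definition symformE := (symformDr, symformNr, symformZr,
                        symformDl, symformNl, symformZl).

End SymmetricForms.

Lemma bounded_form_gt0 (R : realType) (H : normedModType R) (b : H -> H -> R) :
  bounded_form b ->
  exists2 M : R, 0 < M & forall u v : H, `|b u v| <= M * `|u| * `|v|.
Proof.
move=> [M bM]; exists (`|M| + 1) => [|u v]; first by rewrite ltr_wpDl.
apply: le_trans (bM u v) _; rewrite -!mulrA ler_wpM2r// ?mulr_ge0//.
by rewrite (le_trans (ler_norm M))// lerDl.
Qed.

Lemma lipschitz_linear_continuous (R : numFieldType) (V W : normedModType R)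
    (f : {linear V -> W}) (K : R) :
  K \is Num.real -> (forall v, `|f v| <= K * `|v|) -> continuous f.
Proof.
move=> Kreal fK; apply/bounded_linear_continuous/linear_boundedP.
near=> r => v; rewrite (le_trans (fK v))// ler_wpM2r//.
Unshelve. all: by end_near. Qed.

Lemma bounded_form_continuous (R : realType) (H : normedModType R)
    (b : {symmetric H}) (u : H) :
  bounded_form b -> continuous (b u : H -> R).
Proof.
move=> [M bM]; pose bu : {linear H -> R^o} := b u.
apply: (@lipschitz_linear_continuous _ _ _ bu (M * `|u|)); last exact: bM.
exact: num_real.
Qed.

Section LaxMilgram.
Variables (R : realType) (H : completeNormedModType R) (a : {symmetric H}).
Variables (c : R) (c_gt0 : 0 < c).
Hypothesis a_coercive : forall v : H, c * `|v| ^+ 2 <= a v v.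
Hypothesis a_bounded : bounded_form a.

Lemma coercive_inj (u u' : H) : (forall v, a u v = a u' v) -> u = u'.
Proof.
move=> uu'; apply/subr0_eq/normr0_eq0/eqP.
have := a_coercive (u - u'); rewrite symformDl symformNl uu' subrr.
by rewrite pmulr_rle0// le_eqVlt ltNge sqr_ge0 orbF sqrf_eq0.
Qed.

Section Existence.
Variables (l : {linear H -> R^o}) (l_continuous : continuous l).

Let lD u v : l (u + v) = l u + l v :> R. Proof. exact: linearD. Qed.

Let lZ k v : l (k *: v) = k * l v. Proof. exact: linearZ. Qed.

(** Twice the quadratic energy of the problem. Since [a] is symmetric and coercive, its minimisers
    are exactly the solutions of [a u v = l v], so existence is obtained by minimisation. *)
Let J (v : H) : R := a v v - 2 * l v.

Let J_lbound : exists K : R, forall v, K <= J v.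
Proof.
have [k k_gt0 lk] := linear_lipschitz l_continuous.
(* This is the minimum over real [r] of [c r^2 - 2 k r], attained at [r = k / c]; the square is
   completed below. *)
exists (- (k ^+ 2 / c)) => v.
have h : l v <= k * `|v| := le_trans (ler_norm _) (lk v).
rewrite /J; apply: (@le_trans _ _ (c * `|v| ^+ 2 - 2 * (k * `|v|))); last first.
  by rewrite lerB// ler_wpM2l.
have -> : - (k ^+ 2 / c) = c * `|v| ^+ 2 - 2 * (k * `|v|)
    - c * (`|v| - k / c) ^+ 2 by field; rewrite gt_eqF.
by rewrite lerBlDr lerDl mulr_ge0 ?sqr_ge0// ltW.
Qed.

Let d : R := inf (range J).

Let d_le v : d <= J v.
Proof.
apply: ge_inf; last by exists v.
by have [K KJ] := J_lbound; exists K => _ [w _ <-].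
Qed.

Let d_approx (e : R) : 0 < e -> exists v, J v < d + e.
Proof.
move=> e0; have hi : has_inf (range J).
  split; first by exists (J 0), 0.
  by have [K KJ] := J_lbound; exists K => _ [w _ <-].
by have [_ [v _ <-] ve] := inf_adherent e0 hi; exists v.
Qed.

(* The parallelogram law makes the sublevel sets of J shrink to a point. *)
Let J_dist u v e : J u < d + e -> J v < d + e -> c * `|u - v| ^+ 2 <= 4 * e.
Proof.
move=> Ju Jv; apply: le_trans (a_coercive _) _.
have := d_le (2^-1 *: (u + v)); move: Ju Jv.
rewrite /J lZ lD !symformE [a v u]symformC.
by lra.
Qed.

(** The filter generated by the sublevel sets of [J] replaces a minimising sequence. *)
Let F : set_system H :=
  filter_from [set e : R | 0 < e] (fun e => [set v | J v < d + e]).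

Let F_proper : ProperFilter F.
Proof.
apply: filter_from_proper; last by move=> e e0; exact: d_approx.
apply: filter_from_filter; first by exists 1 => /=.
move=> e e' /= e0 e'0; exists (Num.min e e'); first by rewrite /= lt_min e0.
by move=> v /= vd; split=> /=; apply: (lt_le_trans vd);
  rewrite lerD2l ge_min lexx ?orbT.
Qed.

Let F_cvg : cvg F.
Proof.
suff Fc : cauchy_ex F.
  exact: (@cauchy_cvg H F F_proper (@cauchy_exP R H F F_proper Fc)).
move=> e e0.
(* With this choice [J_dist] gives [c |u - v|^2 <= 4 e' = c e^2 / 2], strictly below [c e^2]. *)
pose e' := c * e ^+ 2 / 8.
have e'0 : 0 < e' by rewrite divr_gt0// mulr_gt0// exprn_gt0.
have [u Ju] := d_approx e'0; exists u, e' => //= v /= Jv.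
rewrite -ball_normE /=.
have := J_dist Ju Jv; rewrite /e' => h.
rewrite -(@ltr_pXn2r _ 2)// ?nnegrE ?(ltW e0)// -(ltr_pM2l c_gt0).
apply: (le_lt_trans h); have : 0 < c * e ^+ 2 by rewrite mulr_gt0// exprn_gt0.
lra.
Qed.

(* Expanding a(u - v, u - v) >= 0 bounds J from below by a function that is
   affine in v, hence continuous, and that agrees with J at u. *)
Let J_lim : J (lim F) <= d.
Proof.
set u := lim F; apply/ler_addgt0Pr => e e0.
pose G v : R := 2 * a u v - a u u - 2 * l v.
have -> : J u = G u by rewrite /J /G; ring.
have Gc : G v @[v --> u] --> G u.
  apply: cvgB; last by apply: cvgMr; exact: l_continuous.
  apply: cvgB; last exact: cvg_cst.
  by apply: cvgMr; exact: bounded_form_continuous.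
apply: (@closed_cvg _ _ F F_proper G [set x | x <= d + e]).
- exact: closed_le.
- exists e => //= v /= /ltW Jv; apply: le_trans Jv.
  have := le_trans (mulr_ge0 (ltW c_gt0) (sqr_ge0 _)) (a_coercive (u - v)).
  by rewrite !symformE [a v u]symformC /G /J; lra.
- exact: cvg_trans (cvg_app G F_cvg) Gc.
Qed.

(** First variation at the minimiser [u]: comparing [J u] with [J (u + t v)] gives a quadratic in
    [t] that is nonnegative and has no constant term, so its linear coefficient vanishes. *)
Lemma lax_milgram : exists u, forall v, a u v = l v.
Proof.
pose u := lim F; exists u => v.
have h t : 0 <= 2 * t * (a u v - l v) + t ^+ 2 * a v v.
  have := le_trans J_lim (d_le (u + t *: v)).
  rewrite -/u /J lD lZ !symformE [a v u]symformC.
  by rewrite /GRing.scale/=; lra.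
apply/eqP; rewrite -subr_eq0; set x := a u v - l v in h *.
(* Adding 1 keeps [p] positive even for [v = 0]. At [t = - x / p] the quadratic equals a negative
   multiple of [x ^+ 2], which forces [x = 0]. *)
pose p := a v v + 1; have p0 : 0 < p.
  by rewrite ltr_wpDl// (le_trans _ (a_coercive v))// mulr_ge0 ?sqr_ge0 ?ltW.
have := h (- x / p).
have -> : 2 * (- x / p) * x + (- x / p) ^+ 2 * a v v =
    - (x ^+ 2 * ((p + 1) / p ^+ 2)) by rewrite /p; field; rewrite gt_eqF.
rewrite oppr_ge0 pmulr_lle0 ?divr_gt0 ?exprn_gt0 ?(addr_gt0 p0)//.
by rewrite le_eqVlt ltNge sqr_ge0 orbF sqrf_eq0.
Qed.

Lemma var_solP v : a (var_sol a l) v = l v.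
Proof.
by move: v; exact: (getPex (P := [set u | forall v, a u v = l v]) lax_milgram).
Qed.

Lemma var_sol_eq u : (forall v, a u v = l v) -> var_sol a l = u.
Proof. by move=> al; apply: coercive_inj => v; rewrite al var_solP. Qed.

End Existence.
End LaxMilgram.

(** * Differential calculus *)

Section DifferentialLemmas.
Variables (R : realType) (V W : normedModType R).

Lemma is_diff_littleo0 (f : V -> W) (x : V) :
  f x = 0 ->
  (forall e : R, 0 < e -> \forall h \near (0 : V), `|f (h + x)| <= e * `|h|) ->
  is_diff x f 0.
Proof.
move=> fx0 fo.
have c0 : continuous (0 : V -> W) by move=> y; exact: cvg_cst.
have fE : f \o shift x = cst (f x) + 0 +o_ 0 id.
  apply/eqaddoP => e e0; near=> h.
  rewrite -[X in `|X|]/(f (h + x) - (cst (f x) h + 0)) /cst fx0 addr0 subr0.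
  by near: h; exact: fo.
have d0 : 'd f x = 0 :> (V -> W) by apply/diff_unique.
by apply: DiffDef => //; apply/diff_locallyP; rewrite d0.
Unshelve. all: by end_near. Qed.

(** The difference [g - f] vanishes near [x], hence has differential 0 there, and
    [g = (g - f) + f]. *)
Lemma near_eq_is_diff (f g df : V -> W) (x : V) :
  (\forall y \near x, f y = g y) -> is_diff x f df -> is_diff x g df.
Proof.
move=> fg dfx.
have : is_diff x (g - f) 0.
  apply: is_diff_littleo0 => [|e e0].
    by rewrite -[LHS]/(g x - f x) (nbhs_singleton fg) subrr.
  rewrite (near_shift 0 x) in fg; near=> h.
  rewrite -[X in `|X|]/(g (h + x) - f (h + x)).
  suff -> : f (h + x) = g (h + x) by rewrite subrr normr0 mulr_ge0// ltW.
  have : f (shift (x - 0) h) = g (shift (x - 0) h) by near: h.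
  by rewrite /= subr0.
move=> dgf; apply: (is_diff_eq (f' := 0 + df)); last by rewrite add0r.
have -> : g = g - f + f by rewrite subrK.
exact: is_diffD.
Unshelve. all: by end_near. Qed.

Lemma is_diff_sum (n : nat) (f df : 'I_n -> V -> W) (x : V) :
  (forall i, is_diff x (f i) (df i)) ->
  is_diff x (\sum_(i < n) f i) (\sum_(i < n) df i).
Proof.
move=> fdf; elim/big_ind2 : _ => [|g dg h dh gd hd|i _] //.
  exact: is_diff_cst.
exact: is_diffD.
Qed.

(* Continuity of g suffices because the linear factor vanishes at x. *)
Lemma is_diff_vanishing_scale (phi : {linear V -> R^o}) (g : V -> W) (x : V) :
  continuous phi -> {for x, continuous g} ->
  is_diff x (fun z => phi (z - x) *: g z) (fun h => phi h *: g x).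
Proof.
move=> phic gc.
have [k k0 phik] := linear_lipschitz phic.
(* Splitting [g z] as [(g z - g x) + g x] leaves a term that is little-o, [phi] being Lipschitz and
   [g] continuous at [x], and a term that is affine in [z]. *)
have h0 : is_diff x (fun z => phi (z - x) *: (g z - g x)) 0.
  apply: is_diff_littleo0 => [|e e0]; first by rewrite subrr linear0 scale0r.
  have ek0 : 0 < e / k by rewrite divr_gt0.
  have gx : \forall z \near x, `|g x - g z| <= e / k.
    by move/cvgrPdist_le : gc; exact.
  rewrite (near_shift 0 x) in gx; near=> h.
  rewrite addrK normrZ.
  have : `|g x - g (shift (x - 0) h)| <= e / k by near: h.
  rewrite /= subr0 distrC => gh.
  apply: (le_trans (ler_pM _ _ (phik h) gh)) => //.
  by rewrite mulrAC mulrCA divff ?gt_eqF// mulr1.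
have h1 : is_diff x (fun z => phi (z - x) *: g x) (fun h => phi h *: g x).
  have dphi : is_diff x (phi \o (id - cst x)) (phi \o (id - 0)).
    apply: is_diff_comp.
    by apply: DiffDef; [exact: linear_differentiable|exact: diff_lin].
  have dE : 'd (phi \o (id - cst x)) x = phi :> (V -> R).
    rewrite diff_val; apply/funext => h.
    by rewrite /= -[(id - 0) h]/(h - 0) subr0.
  apply: DiffDef; first exact: (@differentiableZl _ _ _ (phi \o (id - cst x))).
  by rewrite (@diffZl _ _ _ (phi \o (id - cst x)))// dE.
have -> : (fun z => phi (z - x) *: g z) =
    (fun z => phi (z - x) *: (g z - g x)) + (fun z => phi (z - x) *: g x).
  by apply/funext => z; rewrite -[RHS]/(_ *: _ + _ *: _) -scalerDr subrK.
by apply: is_diff_eq; rewrite add0r.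
Unshelve. all: by end_near. Qed.

Lemma derive_linear_comp (W' : normedModType R) (L : {linear W -> W'})
    (f : V -> W) (x v : V) :
  continuous L -> differentiable f x -> 'D_v (L \o f) x = L ('D_v f x).
Proof.
move=> Lc df; have dL := linear_differentiable (f x) Lc.
rewrite !deriveE//; last exact: differentiable_comp.
by rewrite (diff_comp df dL) /= -[in RHS](diff_lin (f x) Lc).
Qed.

End DifferentialLemmas.

(** * Differentiability from a fixed-point equation *)

Section ResolventDifferential.
Variables (R : realType) (n : nat) (V W : normedModType R).

(* Boundedness of w alone turns the fixed-point equation into continuity of w
   at s, and continuity of w then turns it into differentiability. *)
Lemma is_diff_resolvent (f df w : V -> W) (phi : 'I_n -> {linear V -> R^o})
    (L : 'I_n -> {linear W -> W}) (s : V) (M : R) :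
  (forall p, continuous (phi p)) ->
  (forall p, continuous (L p)) ->
  is_diff s f df ->
  (\forall x \near s, `|w x| <= M) ->
  (\forall x \near s,
     w x = f x - \sum_(p < n) phi p (x - s) *: L p (w x)) ->
  is_diff s w (fun h => df h - \sum_(p < n) phi p h *: L p (w s)).
Proof.
move=> phic Lc fdf wM weq.
have wc : {for s, continuous w}.
  (* The sum of zeros is kept so that the limit has the shape of the right-hand side and can be
     taken term by term. *)
  have ws : w s = f s - \sum_(p < n) 0.
    rewrite {1}(nbhs_singleton weq); congr (_ - _); apply: eq_bigr => p _.
    by rewrite subrr linear0 scale0r.
  suff : w x @[x --> s] --> f s - \sum_(p < n) 0 by rewrite -ws.
  pose rhs x := f x - \sum_(p < n) phi p (x - s) *: L p (w x).
  apply: (@cvg_trans _ (rhs @ s)).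
    by apply: near_eq_cvg; apply: filterS weq => x; exact: esym.
  apply: cvgB; first by apply: differentiable_continuous.
  apply: cvg_big => [|p _]; first exact: add_continuous.
  have [k k0 Lk] := linear_lipschitz (Lc p).
  apply/cvgr0Pnorm_le => e e0.
  have ekM : 0 < e / (k * (`|M| + 1)).
    by rewrite divr_gt0// mulr_gt0// ltr_wpDl.
  have : \forall x \near s, `|phi p (x - s)| <= e / (k * (`|M| + 1)).
    have : phi p (x - s) @[x --> s] --> phi p (s - s).
      apply: (continuous_comp (f := fun x => x - s)); last exact: phic.
      by apply: cvgB; [exact: cvg_id|exact: cvg_cst].
    by rewrite subrr linear0 => /cvgr0Pnorm_le; exact.
  move=> ce; near=> x; rewrite normrZ.
  have h1 : `|phi p (x - s)| <= e / (k * (`|M| + 1)) by near: x.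
  have h2 : `|L p (w x)| <= k * (`|M| + 1).
    apply: (le_trans (Lk _)); rewrite ler_wpM2l ?(ltW k0)//.
    have : `|w x| <= M by near: x.
    by move/le_trans; apply; rewrite (le_trans (ler_norm M))// lerDl.
  apply: (le_trans (ler_pM _ _ h1 h2)) => //.
  by rewrite divfK// gt_eqF// mulr_gt0// ltr_wpDl.
apply: (near_eq_is_diff
  (f := f - \sum_(p < n) (fun x => phi p (x - s) *: L p (w x)))).
  apply: filterS weq => x /esym <-.
  by rewrite -[LHS]/(f x - (\sum_(p < n) _) x) fct_sumE.
apply: is_diff_eq; first apply: is_diffB.
  apply: is_diff_sum => p; apply: is_diff_vanishing_scale.
    exact: phic.
  by apply: continuous_comp => //; exact: Lc.
by apply/funext => h; rewrite -[LHS]/(df h - (\sum_(p < n) _) h) fct_sumE.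
Unshelve. all: by end_near. Qed.

End ResolventDifferential.

Section RowCoordinates.
Variables (R : realType) (n : nat).

(** The codomain is [R^o], so that coordinates are linear maps between normed modules and can serve
    as the [phi p] of [is_diff_resolvent]. *)
Definition row_coord (p : 'I_n) (x : 'rV[R]_n) : R^o := x ord0 p.

Fact row_coord_linear p : linear (row_coord p).
Proof. by move=> k x y; rewrite /row_coord !mxE. Qed.

HB.instance Definition _ p :=
  GRing.isLinear.Build _ _ _ _ (row_coord p) (row_coord_linear p).

Lemma continuous_row_coord p : continuous (row_coord p).
Proof. exact: coord_continuous. Qed.

End RowCoordinates.

(** * Closure properties of k-fold differentiability on an open set *)

Section NtimesDifferentiable.
Variables (R : realType) (n : nat) (U : set 'rV[R]_n).
Hypothesis U_open : forall x, U x -> \forall y \near x, U y.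

(** Openness turns equality on [U] into equality near each point of [U], so partial derivatives
    agree on [U] too and the induction proceeds. Derivative formulas known only on [U] can thus be
    substituted. *)
Lemma ntimes_differentiable_eq (W : normedModType R) k (f g : 'rV[R]_n -> W) :
  (forall x, U x -> f x = g x) ->
  ntimes_differentiable k U f -> ntimes_differentiable k U g.
Proof.
elim: k f g => // k IH f g fg [df dpf]; split=> [x Ux|i].
  have fgx : \forall y \near x, f y = g y by apply: filterS (U_open Ux).
  by have [] := near_eq_is_diff fgx (differentiableP (df x Ux)).
apply: IH (dpf i) => x Ux; apply: near_eq_derive.
by apply: filterS (U_open Ux).
Qed.

Lemma ntimes_differentiable_leS (W : normedModType R) k (f : 'rV[R]_n -> W) :
  ntimes_differentiable k.+1 U f -> ntimes_differentiable k U f.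
Proof.
elim: k f => // k IH f [df dpf]; split=> // i; exact: IH.
Qed.

Lemma ntimes_differentiable_linear (W W' : normedModType R) k
    (L : {linear W -> W'}) (f : 'rV[R]_n -> W) :
  continuous L -> ntimes_differentiable k U f ->
  ntimes_differentiable k U (L \o f).
Proof.
move=> Lc; elim: k f => // k IH f [df dpf].
split=> [x Ux|i].
  by apply: differentiable_comp; [exact: df|exact: linear_differentiable].
apply: ntimes_differentiable_eq (IH _ (dpf i)) => x Ux.
by rewrite /= /partial_deriv derive_linear_comp//; exact: df.
Qed.

Lemma ntimes_differentiableD (W : normedModType R) k (f g : 'rV[R]_n -> W) :
  ntimes_differentiable k U f -> ntimes_differentiable k U g ->
  ntimes_differentiable k U (f + g).
Proof.
elim: k f g => // k IH f g [df dpf] [dg dpg].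
split=> [x Ux|i].
  by apply: differentiableD; [exact: df|exact: dg].
apply: ntimes_differentiable_eq (IH _ _ (dpf i) (dpg i)) => x Ux.
have dfx := df _ Ux; have dgx := dg _ Ux.
by rewrite [RHS]deriveD//; apply: diff_derivable.
Qed.

Lemma ntimes_differentiableN (W : normedModType R) k (f : 'rV[R]_n -> W) :
  ntimes_differentiable k U f -> ntimes_differentiable k U (- f).
Proof.
move=> df; have -> : - f = -%R \o f by [].
by apply: ntimes_differentiable_linear => //; exact: opp_continuous.
Qed.

Lemma ntimes_differentiable_cst0 (W : normedModType R) k :
  ntimes_differentiable k U (0 : 'rV[R]_n -> W).
Proof.
elim: k => // k IH; split=> [x Ux|i]; first exact: differentiable_cst.
by apply: ntimes_differentiable_eq IH => x Ux; rewrite [RHS]derive_cst.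
Qed.

Lemma ntimes_differentiable_sum (W : normedModType R) k (I : Type) (r : seq I)
    (f : I -> 'rV[R]_n -> W) :
  (forall i, ntimes_differentiable k U (f i)) ->
  ntimes_differentiable k U (\sum_(i <- r) f i).
Proof.
move=> df; elim/big_ind : _ => //; last exact: ntimes_differentiableD.
exact: ntimes_differentiable_cst0.
Qed.

End NtimesDifferentiable.

Lemma sum_row_coord_delta (R : realType) (n : nat) (W : lmodType R)
    (i : 'I_n) (F : 'I_n -> W) :
  \sum_(p < n) row_coord p (delta_mx ord0 i : 'rV[R]_n) *: F p = F i.
Proof.
rewrite (bigD1 i)//= big1 => [|p pi].
  by rewrite /row_coord mxE !eqxx scale1r addr0.
by rewrite /row_coord mxE eqxx (negbTE pi) scale0r.
Qed.

(** * Smoothness from resolvent identities, for abstract families *)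

Section ResolventFamily.
Variables (R : realType) (n : nat) (H : normedModType R) (U : set 'rV[R]_n).
Variable T : 'I_n -> 'rV[R]_n -> H -> H.
Hypothesis U_open : forall x, U x -> \forall y \near x, U y.
Hypothesis T_linear : forall p s, U s -> linear (T p s).
Hypothesis T_bounded : forall p s, U s ->
  exists K, \forall x \near s, forall v, `|T p x v| <= K * `|v|.
Hypothesis T_resolvent : forall i s x v, U s -> U x ->
  T i x v = T i s v - \sum_(p < n) row_coord p (x - s) *: T p s (T i x v).

(** Linearity of [T p s] is available only for [s] in [U], so the linear structure is packed
    pointwise rather than declared once. *)
Lemma resolvent_continuous_linear s : U s ->
  exists L : 'I_n -> {linear H -> H},
    forall p, continuous (L p) /\ L p = T p s :> (H -> H).
Proof.
move=> Us.
pose L p : {linear H -> H} :=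
  HB.pack (T p s) (GRing.isLinear.Build _ _ _ _ _ (T_linear p Us)).
exists L => p; split=> //; have [K /nbhs_singleton TK] := T_bounded p Us.
by apply: (lipschitz_linear_continuous (K := K)) => //; exact: num_real.
Qed.

(** For frozen [s], the identity for [T i x (g x)] is the fixed-point equation of
    [is_diff_resolvent] with [f] the composite of [T i s] and [g]. *)
Lemma is_diff_resolvent_family i (g dg : 'rV[R]_n -> H) s :
  U s -> is_diff s g dg ->
  is_diff s (fun x => T i x (g x)) (fun h =>
    T i s (dg h) - \sum_(p < n) row_coord p h *: T p s (T i s (g s))).
Proof.
move=> Us gdg; have [L LT] := resolvent_continuous_linear Us.
have [K TK] := T_bounded i Us.
have LTE p : T p s = L p by rewrite (LT p).2.
have Lc p := (LT p).1.
have -> : (fun h => T i s (dg h) -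
      \sum_(p < n) row_coord p h *: T p s (T i s (g s))) =
    (fun h => L i (dg h) - \sum_(p < n) row_coord p h *: L p (T i s (g s))).
  apply/funext => h; rewrite -LTE; congr (_ - _).
  by apply: eq_bigr => p _; rewrite LTE.
have gM : \forall x \near s, `|g x| <= `|g s| + 1.
  have /cvgrPdist_le/(_ _ ltr01) : {for s, continuous g}.
    by apply: differentiable_continuous.
  apply: filterS => x gx; rewrite -lerBlDl.
  by apply: le_trans gx; rewrite distrC lerB_dist.
apply: (is_diff_resolvent (f := L i \o g) (df := L i \o dg)
    (M := `|K| * (`|g s| + 1)) (phi := @row_coord R n)) => //.
- exact: continuous_row_coord.
- apply: is_diff_comp; apply: DiffDef; first exact: linear_differentiable.
  exact: diff_lin.
- near=> x; have TKx : forall v, `|T i x v| <= K * `|v| by near: x.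
  have gx : `|g x| <= `|g s| + 1 by near: x.
  apply: (le_trans (TKx _)).
  apply: (@le_trans _ _ (`|K| * `|g x|)); first by rewrite ler_wpM2r// ler_norm.
  by rewrite ler_wpM2l.
- near=> x; have Ux : U x by near: x; exact: U_open.
  rewrite [LHS](T_resolvent _ _ Us Ux) /= LTE.
  by congr (_ - _); apply: eq_bigr => p _; rewrite LTE.
Unshelve. all: by end_near. Qed.

Lemma ntimes_differentiable_resolvent_family k i (g : 'rV[R]_n -> H) :
  ntimes_differentiable k U g ->
  ntimes_differentiable k U (fun x => T i x (g x)).
Proof.
elim: k i g => // k IH i g gk; have [dg dpg] := gk.
(* The derivative contains [T j x (T i x (g x))], handled by two uses of the induction hypothesis;
   these need [g] at order [k]. *)
have gk' := ntimes_differentiable_leS gk.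
split=> [x Ux|j].
  have dgx := dg _ Ux.
  by have [] := is_diff_resolvent_family i Ux (differentiableP dgx).
apply: ntimes_differentiable_eq (ntimes_differentiableD U_open
  (IH i _ (dpg j)) (ntimes_differentiableN U_open (IH j _ (IH i _ gk')))) => //.
move=> x Ux; have dgx := dg _ Ux.
have dT := is_diff_resolvent_family i Ux (differentiableP dgx).
rewrite [RHS]deriveE// diff_val sum_row_coord_delta.
by rewrite -[LHS]/(T i x ('D__ g x) - T j x (T i x (g x))) (deriveE _ dgx).
Qed.

Variable u : 'rV[R]_n -> H.
Hypothesis u_bounded : forall s, U s ->
  exists K, \forall x \near s, `|u x| <= K.
Hypothesis u_resolvent : forall s x, U s -> U x ->
  u x = u s - \sum_(p < n) row_coord p (x - s) *: T p s (u x).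

(** Here the fixed-point equation has the constant [u s] in place of [f], so only the sum
    contributes. *)
Lemma is_diff_resolvent_solution s : U s ->
  is_diff s u (fun h => - \sum_(p < n) row_coord p h *: T p s (u s)).
Proof.
move=> Us; have [L LT] := resolvent_continuous_linear Us.
have LTE p : T p s = L p by rewrite (LT p).2.
have [K uK] := u_bounded Us.
apply: (is_diff_eq (f' := fun h =>
   0 - \sum_(p < n) row_coord p h *: L p (u s))).
  apply: (is_diff_resolvent (f := cst (u s)) (df := 0)
    (M := K) (phi := @row_coord R n)) => //.
  - exact: continuous_row_coord.
  - by move=> p; exact: (LT p).1.
  - near=> x; have Ux : U x by near: x; exact: U_open.
    rewrite {1}(u_resolvent Us Ux) /=.
    by congr (_ - _); apply: eq_bigr => p _; rewrite LTE.
apply/funext => h; rewrite sub0r; congr (- _).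
by apply: eq_bigr => p _; rewrite LTE.
Unshelve. all: by end_near. Qed.

Lemma partial_deriv_resolvent_solution i s : U s ->
  partial_deriv i u s = - T i s (u s).
Proof.
move=> Us; have du := is_diff_resolvent_solution Us.
by rewrite /partial_deriv deriveE// diff_val sum_row_coord_delta.
Qed.

(** Bootstrap: the partial derivatives of [u] are [- T i s (u s)], which inherit order [k] from [u];
    hence [u] has order [k.+1]. *)
Lemma smooth_on_resolvent_solution : smooth_on U u.
Proof.
elim=> // k IH; split=> [x Ux|i].
  by have [] := is_diff_resolvent_solution Ux.
apply: ntimes_differentiable_eq (ntimes_differentiableN U_open
  (ntimes_differentiable_resolvent_family i IH)) => //.
by move=> x Ux; rewrite partial_deriv_resolvent_solution.
Qed.

End ResolventFamily.

(** * The affine family of forms *)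

Section AffineForm.
Variables (R : realType) (H : normedModType R) (n : nat).
Variables (b0 : {symmetric H}) (b : 'I_n -> {symmetric H}).
Implicit Types s x : 'rV[R]_n.

Fact affine_form_bilinear s : bilinear_for
  (GRing.Scale.Law.clone _ _ *%R _)
  (GRing.Scale.Law.clone _ _ (idfun \; *%R) _)
  (affine_form b0 b s : H -> H -> R).
Proof.
split=> [w|w] k u v /=; rewrite /affine_form !symformE mulrDr mulr_sumr;
  rewrite addrACA -big_split/=; congr (_ + _); apply: eq_bigr => i _;
  by rewrite !symformE mulrDr mulrCA.
Qed.

Fact affine_form_sym s (u v : H) :
  affine_form b0 b s u v = (-1) ^+ false * idfun (affine_form b0 b s v u).
Proof.
rewrite expr0 mul1r /affine_form symformC; congr (_ + _).
by apply: eq_bigr => i _; rewrite symformC.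
Qed.

HB.instance Definition _ s := bilinear_isBilinear.Build _ _ _ _ _ _
  (affine_form b0 b s : H -> H -> R) (affine_form_bilinear s).

HB.instance Definition _ s := isHermitianSesquilinear.Build _ _ _ _
  (affine_form b0 b s : H -> H -> R) (@affine_form_sym s).

(** The same function with its symmetric bilinear structure attached, so that [symformC] and
    [symformE] apply. *)
Definition affine_symform s : {symmetric H} := affine_form b0 b s.

(** Affine dependence on the coefficients, the source of both the resolvent identity and the
    derivative term of the energy identity. *)
Lemma affine_formE s x u v : affine_form b0 b x u v =
  affine_form b0 b s u v + \sum_(p < n) row_coord p (x - s) * b p u v.
Proof.
rewrite /affine_form -addrA -big_split/=; congr (_ + _).
by apply: eq_bigr => p _; rewrite /row_coord !mxE; ring.
Qed.

Hypothesis b0_bounded : bounded_form b0.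
Hypothesis b_bounded : forall i, bounded_form (b i).

Lemma affine_form_bounded s : bounded_form (affine_form b0 b s).
Proof.
have [M0 b0M] := b0_bounded; have /choice[M bM] := b_bounded.
exists (M0 + \sum_(i < n) `|s ord0 i| * M i) => u v.
rewrite !mulrDl !mulr_suml.
apply: (le_trans (ler_normD _ _)); rewrite lerD//.
apply: (le_trans (ler_norm_sum _ _ _)); apply: ler_sum => i _.
by rewrite normrM -!mulrA ler_wpM2l// mulrA.
Qed.

Hypothesis b0_psd : possemidef_form b0.
Hypothesis b_psd : forall i, possemidef_form (b i).

Lemma affine_form_psd s :
  pos_orthant R n s -> possemidef_form (affine_form b0 b s).
Proof.
move=> s0 v; rewrite addr_ge0 ?b0_psd// sumr_ge0// => i _.
by rewrite mulr_ge0 ?b_psd// ltW.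
Qed.

Variable beta : R.
Hypothesis beta_gt0 : 0 < beta.
Hypothesis b1_coercive : forall v : H,
  beta * `|v| ^+ 2 <= affine_form b0 b (const_mx 1) v v.

Lemma pos_orthant_near_ge s : pos_orthant R n s ->
  exists d : R, [/\ 0 < d, d <= 1 &
    \forall x \near s, forall i : 'I_n, d <= (x : 'rV[R]_n) ord0 i].
Proof.
(* Starting the minimum at 1 covers [n = 0] and ensures [d <= 1]; halving it leaves room for [x] to
   move around [s]. *)
move=> s0; pose m : R := \big[Num.min/1]_(i < n) s ord0 i.
have m0 : 0 < m by apply: lt_bigmin.
have m1 : m <= 1 by exact: bigmin_le_id.
exists (m / 2); split; [by rewrite divr_gt0|by lra|].
have mi i : \forall x \near s, m / 2 <= row_coord i x.
  have : m / 2 < row_coord i s.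
    by apply: (@lt_le_trans _ _ m); [lra|exact: bigmin_le].
  move/(cvgr_gt _ (@continuous_row_coord R n i s)).
  by apply: filterS => x /ltW.
exact: (filter_forall (nbhs_filter s) mi).
Qed.

Lemma pos_orthant_near s :
  pos_orthant R n s -> \forall x \near s, pos_orthant R n x.
Proof.
move=> /pos_orthant_near_ge[d [d0 _]]; apply: filterS => x dx i.
exact: lt_le_trans (dx i).
Qed.

(** If all entries of [x] are at least [d] and [d <= 1], then the form at [x] dominates [d] times
    the form at the all-ones vector: [d <= 1] handles [b0], the entries handle each [b i]. *)
Lemma affine_form_coercive_near s : pos_orthant R n s ->
  exists2 c : R, 0 < c &
    \forall x \near s, forall v, c * `|v| ^+ 2 <= affine_form b0 b x v v.
Proof.
move=> /pos_orthant_near_ge[d [d0 d1 dx]].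
exists (d * beta); first by rewrite mulr_gt0.
apply: filterS dx => x dx v.
apply: (@le_trans _ _ (d * affine_form b0 b (const_mx 1) v v)).
  by rewrite -mulrA ler_pM2l.
rewrite /affine_form mulrDr mulr_sumr lerD//; first by rewrite ler_piMl.
by apply: ler_sum => i _; rewrite mxE mul1r ler_wpM2r// b_psd.
Qed.

Lemma affine_form_coercive s : pos_orthant R n s ->
  exists2 c : R, 0 < c & forall v, c * `|v| ^+ 2 <= affine_form b0 b s v v.
Proof.
by move=> /affine_form_coercive_near[c c0 /nbhs_singleton]; exists c.
Qed.

End AffineForm.

Lemma coercive_bound (R : realFieldType) (H : normedModType R) (w : H)
    (x c K : R) :
  0 < c -> 0 <= K -> c * `|w| ^+ 2 <= x -> x <= K * `|w| -> `|w| <= K / c.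
Proof.
move=> c0 K0 cx xK; have [->|w0] := eqVneq w 0.
  by rewrite normr0 divr_ge0// ltW.
rewrite ler_pdivlMr// mulrC -(ler_pM2r (_ : 0 < `|w|)) ?normr_gt0//.
by rewrite -mulrA -expr2 (le_trans cx).
Qed.

(** * Variational solutions as functions of the coefficients *)

Section Solutions.
Variables (R : realType) (H : completeNormedModType R) (n : nat).
Variables (b0 : {symmetric H}) (b : 'I_n -> {symmetric H}).
Hypothesis b0_bounded : bounded_form b0.
Hypothesis b_bounded : forall i, bounded_form (b i).
Hypothesis b0_psd : possemidef_form b0.
Hypothesis b_psd : forall i, possemidef_form (b i).
Variable beta : R.
Hypothesis beta_gt0 : 0 < beta.
Hypothesis b1_coercive : forall v : H,
  beta * `|v| ^+ 2 <= affine_form b0 b (const_mx 1) v v.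

Local Notation U := (pos_orthant R n).
Local Notation B s := (affine_form b0 b s).
Implicit Types (s x : 'rV[R]_n) (l : {linear H -> R^o}).

Lemma affine_solP s l v : U s -> continuous l -> B s (var_sol (B s) l) v = l v.
Proof.
move=> Us lc; have [c c0 Bc] :=
  affine_form_coercive b0_psd b_psd beta_gt0 b1_coercive Us.
apply: (var_solP (a := affine_symform b0 b s) c0 Bc) => //.
exact: affine_form_bounded.
Qed.

Lemma affine_sol_eq s l (u : H) : U s -> continuous l ->
  (forall v, B s u v = l v) -> var_sol (B s) l = u.
Proof.
move=> Us lc; have [c c0 Bc] :=
  affine_form_coercive b0_psd b_psd beta_gt0 b1_coercive Us.
apply: (var_sol_eq (a := affine_symform b0 b s) c0 Bc) => //.
exact: affine_form_bounded.
Qed.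

(** One [c] and one neighbourhood serve all functionals [l]. This uniformity is needed when [l] is
    [b p w] with [w] arbitrary. *)
Lemma affine_sol_bounded s : U s -> exists2 c : R, 0 < c &
  \forall x \near s, forall l (K : R), 0 <= K -> continuous l ->
    (forall v, `|l v| <= K * `|v|) -> `|var_sol (B x) l| <= K / c.
Proof.
move=> Us; have [c c0 Bc] :=
  affine_form_coercive_near b0_psd b_psd beta_gt0 b1_coercive Us.
exists c => //; near=> x => l K K0 lc lK.
have Ux : U x by near: x; exact: pos_orthant_near.
have Bxc : forall v, c * `|v| ^+ 2 <= B x v v by near: x.
apply: (coercive_bound c0 K0 (Bxc _)).
by rewrite affine_solP// (le_trans (ler_norm _)).
Unshelve. all: by end_near. Qed.

(** The operator T_p(s): in terms of the operators representing the forms, the inverse of that of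
    [B s] composed with that of [b p]. *)
Definition form_resolvent (p : 'I_n) s (w : H) : H := var_sol (B s) (b p w).

Let b_linear p w : {linear H -> R^o} := b p w.

Let b_continuous p w : continuous (b_linear p w).
Proof. exact: bounded_form_continuous. Qed.

Lemma form_resolventP p s w v : U s -> B s (form_resolvent p s w) v = b p w v.
Proof. by move=> Us; exact: (affine_solP (l := b_linear p w)). Qed.

Lemma form_resolvent_linear p s : U s -> linear (form_resolvent p s).
Proof.
move=> Us k w w'.
apply: (affine_sol_eq (l := b_linear p (k *: w + w'))) => // v.
rewrite -[RHS]/(b p (k *: w + w') v).
rewrite -[B s]/(affine_symform b0 b s : H -> H -> R) !symformE.
by rewrite [X in k * X]form_resolventP// [X in _ + X]form_resolventP.
Qed.

Lemma form_resolvent_bounded p s : U s ->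
  exists K, \forall x \near s, forall w, `|form_resolvent p x w| <= K * `|w|.
Proof.
move=> Us; have [c c0 sc] := affine_sol_bounded Us.
have [M M0 bM] := bounded_form_gt0 (b_bounded p).
exists (M / c); apply: filterS sc => x sc w.
rewrite mulrAC; apply: (sc (b_linear p w)) => //; last exact: bM.
by rewrite mulr_ge0// ltW.
Qed.

(** By uniqueness at [s]: with [w] the solution at [x] and [r] the sum, [B s (w + r) v] equals
    [B s w v] plus the sum of the [(x - s)_p b_p(w, v)], which is [B x w v = l v]. *)
Lemma var_sol_resolvent l s x : continuous l -> U s -> U x ->
  var_sol (B x) l = var_sol (B s) l -
    \sum_(p < n) row_coord p (x - s) *: form_resolvent p s (var_sol (B x) l).
Proof.
move=> lc Us Ux; set w := var_sol (B x) l; set r := \sum_(p < n) _.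
suff -> : var_sol (B s) l = w + r by rewrite addrK.
apply: affine_sol_eq => // v.
rewrite -[B s]/(affine_symform b0 b s : H -> H -> R) symformDl /r symform_suml.
rewrite -(affine_solP v Ux lc) (affine_formE _ _ s x); congr (_ + _).
by apply: eq_bigr => p _; rewrite symformZl [X in _ * X]form_resolventP.
Qed.

Lemma var_sol_bounded l s : continuous l -> U s ->
  exists K, \forall x \near s, `|var_sol (B x) l| <= K.
Proof.
move=> lc Us; have [c c0 sc] := affine_sol_bounded Us.
have [K K0 lK] := linear_lipschitz lc.
by exists (K / c); apply: filterS sc => x; apply => //; exact: ltW.
Qed.

Lemma var_sol_smooth l : continuous l -> smooth_on U (fun s => var_sol (B s) l).
Proof.
move=> lc; apply: (smooth_on_resolvent_solution (T := form_resolvent)).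
- exact: pos_orthant_near.
- exact: form_resolvent_linear.
- exact: form_resolvent_bounded.
(* [form_resolvent i x v] is itself a solution, for the functional [b i v], which does not depend on
   [x]. *)
- by move=> i s x v Us Ux; exact: (var_sol_resolvent (l := b_linear i v)).
- by move=> s; exact: var_sol_bounded.
- by move=> s x Us Ux; exact: var_sol_resolvent.
Qed.

Lemma partial_deriv_var_sol l i s : continuous l -> U s ->
  partial_deriv i (fun s => var_sol (B s) l) s =
  - form_resolvent i s (var_sol (B s) l).
Proof.
move=> lc; apply: (partial_deriv_resolvent_solution (T := form_resolvent)).
- exact: pos_orthant_near.
- exact: form_resolvent_linear.
- exact: form_resolvent_bounded.
- by move=> s'; exact: var_sol_bounded.
- by move=> s' x Us Ux; exact: var_sol_resolvent.
Qed.

(** * The measurement map: smoothness, derivatives and energy identity *)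

Section Measurements.
Variables (m : nat) (l : 'I_m -> {linear H -> R^o}).
Hypothesis l_continuous : forall j, continuous (l j).

Local Notation F := (measurement_map b0 b l).
Local Notation u s j := (var_sol (B s) (l j)).

(** On [U], [F] is the finite sum of the images of the smooth solutions [u s j] under the continuous
    linear maps [E j i], which send [h] to [l i h] times a matrix unit. *)
Lemma measurement_map_smooth : smooth_on U F.
Proof.
move=> k; have U_near := @pos_orthant_near R n.
pose e j i (h : H) : 'M[R]_m := (l i h : R) *: delta_mx j i.
have e_lin j i : linear (e j i).
  by move=> c v w; rewrite /e linearP /= scalerDl scalerA.
pose E j i : {linear H -> 'M[R]_m} :=
  HB.pack (e j i) (GRing.isLinear.Build _ _ _ _ _ (e_lin j i)).
have E_cont j i : continuous (E j i).
  move=> h; apply: (continuous_comp (f := l i : H -> R)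
    (g := fun c : R => c *: delta_mx j i)); first exact: l_continuous.
  exact: scalel_continuous.
apply: (ntimes_differentiable_eq U_near
  (f := \sum_(j < m) \sum_(i < m) (E j i \o (fun s => u s j)))).
  move=> s Us; rewrite fct_sumE [RHS]matrix_sum_delta; apply: eq_bigr => j _.
  by rewrite fct_sumE; apply: eq_bigr => i _; rewrite mxE.
apply: ntimes_differentiable_sum => // j.
apply: ntimes_differentiable_sum => // i.
by apply: ntimes_differentiable_linear => //; exact: var_sol_smooth.
Qed.

Lemma measurement_mapE s : U s ->
  F s = \matrix_(j, k) B s (u s j) (u s k).
Proof.
move=> Us; apply/matrixP => j k; rewrite !mxE.
by rewrite [RHS](symformC (affine_symform b0 b s)) [RHS]affine_solP.
Qed.

(** Entrywise, with T_i the form resolvent: [l_k(d_i u_j) = - l_k(T_i u_j) = - b_s(T_i u_j, u_k) = -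
    b_i(u_j, u_k)]. *)
Lemma partial_deriv_measurement_map i s : U s ->
  partial_deriv i F s = - \matrix_(j, k) b i (u s j) (u s k).
Proof.
move=> Us; have [dF _] := measurement_map_smooth 1%N.
rewrite /partial_deriv derive_mx; last exact: diff_derivable (dF s Us).
apply/matrixP => j k; rewrite !mxE.
have [du _] := var_sol_smooth (@l_continuous j) 1%N.
have FE : (fun x => F x j k) = l k \o (fun x => u x j).
  by apply/funext => x; rewrite mxE.
rewrite FE.
rewrite [LHS](derive_linear_comp _ (@l_continuous k) (du s Us)).
rewrite -[derive _ _ _]/(partial_deriv i (fun s => u s j) s).
rewrite (partial_deriv_var_sol i (@l_continuous j) Us) linearN.
congr (- _); rewrite -(affine_solP _ Us (@l_continuous k)).
by rewrite [LHS](symformC (affine_symform b0 b s)) [LHS]form_resolventP.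
Qed.

Lemma dir_deriv_measurement_map s t : U s ->
  dir_deriv F s t =
  - \sum_(i < n) t ord0 i *: \matrix_(j, k) b i (u s j) (u s k).
Proof.
move=> Us; rewrite /dir_deriv -sumrN; apply: eq_bigr => i _.
by rewrite partial_deriv_measurement_map// scalerN.
Qed.

(** Expanding the right-hand side gives four terms. Those containing a solution at [s] reduce to
    values of the functionals; [b_s(u0_j, u0_k)] is expanded around [s0], and its increment is the
    derivative term. *)
Lemma measurement_map_energy s s0 : U s -> U s0 ->
  F s - F s0 - dir_deriv F s0 (s - s0) =
  \matrix_(j, k) B s (u s j - u s0 j) (u s k - u s0 k).
Proof.
move=> Us Us0; rewrite dir_deriv_measurement_map// opprK.
apply/matrixP => j k; rewrite !mxE summxE.
have BB v v' w w' : B s (v - v') (w - w') =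
    B s v w - B s v w' - B s v' w + B s v' w'.
  by rewrite -[B s]/(affine_symform b0 b s : H -> H -> R) !symformE; ring.
rewrite BB !affine_solP//.
have BC x v w : B x v w = B x w v by exact: (symformC (affine_symform b0 b x)).
rewrite (BC s _ (u s k)) affine_solP// (affine_formE _ _ s0 s) affine_solP//.
have -> : \sum_(i < n) row_coord i (s - s0) * b i (u s0 j) (u s0 k) =
  \sum_(i < n) ((s - s0) ord0 i *:
    \matrix_(j', k') b i (u s0 j') (u s0 k')) j k.
  by apply: eq_bigr => i _; rewrite /row_coord !mxE.
have uC x : U x -> l j (u x k) = l k (u x j).
  move=> Ux; rewrite -(affine_solP _ Ux (@l_continuous j)) BC.
  by rewrite affine_solP.
by rewrite !uC//; ring.
Qed.

End Measurements.
End Solutions.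

(** * Gram matrices *)

Section PositiveSemidefiniteMatrices.
Variables (R : realType) (m : nat).
Implicit Types A B : 'M[R]_m.

Lemma symmetricmxP A : reflect (forall i j, A i j = A j i) (A \is symmetricmx).
Proof.
rewrite is_hermitianmxE expr0 scale1r; apply: (iffP eqP) => [AE i j|AE].
  by rewrite [in LHS]AE !mxE.
by apply/matrixP => i j; rewrite !mxE AE.
Qed.

Lemma possemidefmx0 : possemidefmx (0 : 'M[R]_m).
Proof.
split=> [|x]; last by rewrite mulmx0 mul0mx mxE.
by apply/symmetricmxP => i j; rewrite !mxE.
Qed.

Lemma possemidefmxD A B :
  possemidefmx A -> possemidefmx B -> possemidefmx (A + B).
Proof.
move=> [/symmetricmxP As A0] [/symmetricmxP Bs B0]; split=> [|x].
  by apply/symmetricmxP => i j; rewrite !mxE As Bs.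
by rewrite mulmxDr mulmxDl mxE addr_ge0.
Qed.

Lemma possemidefmxZ (k : R) A :
  0 <= k -> possemidefmx A -> possemidefmx (k *: A).
Proof.
move=> k0 [/symmetricmxP As A0]; split=> [|x].
  by apply/symmetricmxP => i j; rewrite !mxE As.
by rewrite -scalemxAr -scalemxAl mxE mulr_ge0.
Qed.

Lemma possemidefmx_sum (I : Type) (r : seq I) (A : I -> 'M[R]_m) :
  (forall i, possemidefmx (A i)) -> possemidefmx (\sum_(i <- r) A i).
Proof.
move=> A0; elim/big_ind : _ => //; first exact: possemidefmx0.
exact: possemidefmxD.
Qed.

Variables (H : lmodType R) (a : {symmetric H}) (v : 'I_m -> H).

Lemma gram_symmetric : (\matrix_(j, k) a (v j) (v k)) \is symmetricmx.
Proof. by apply/symmetricmxP => i j; rewrite !mxE symformC. Qed.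

(** Bilinearity moves the coefficients into the arguments, reducing definiteness of a Gram matrix to
    that of [a] on linear combinations of the [v j]. *)
Lemma gram_quadratic (x : 'cV[R]_m) :
  (x^T *m \matrix_(j, k) a (v j) (v k) *m x) ord0 ord0 =
  a (\sum_(j < m) x j ord0 *: v j) (\sum_(j < m) x j ord0 *: v j).
Proof.
rewrite mxE symform_suml; apply: eq_bigr => k _.
rewrite mxE symformZl [a (v k) _]symformC symform_suml mulrC; congr (_ * _).
by apply: eq_bigr => j _; rewrite !mxE symformZl.
Qed.

Lemma possemidefmx_gram :
  (forall w, 0 <= a w w) -> possemidefmx (\matrix_(j, k) a (v j) (v k)).
Proof.
by move=> a0; split=> [|x]; [exact: gram_symmetric|rewrite gram_quadratic].
Qed.

End PositiveSemidefiniteMatrices.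

Lemma dir_derivD (R : realType) (n : nat) (W : normedModType R)
    (f : 'rV[R]_n -> W) (x v w : 'rV[R]_n) :
  dir_deriv f x (v + w) = dir_deriv f x v + dir_deriv f x w.
Proof.
by rewrite /dir_deriv -big_split/=; apply: eq_bigr => i _; rewrite mxE scalerDl.
Qed.

Lemma dir_derivZ (R : realType) (n : nat) (W : normedModType R)
    (f : 'rV[R]_n -> W) (x : 'rV[R]_n) (k : R) (v : 'rV[R]_n) :
  dir_deriv f x (k *: v) = k *: dir_deriv f x v.
Proof.
by rewrite /dir_deriv scaler_sumr; apply: eq_bigr => i _; rewrite mxE scalerA.
Qed.

Theorem lemma2 (R : realType) (H : completeNormedModType R)
  (ip : {dot H for (@idfun R)}) (Hilbert : norm_from_dot ip)
  (n : nat) (b0 : {symmetric H}) (b : 'I_n -> {symmetric H})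
  (b0_bounded : bounded_form b0) (b_bounded : forall i, bounded_form (b i))
  (b0_psd : possemidef_form b0) (b_psd : forall i, possemidef_form (b i))
  (beta C : R) (beta_gt0 : 0 < beta) (C_gt0 : 0 < C)
  (b1_bounds : forall v : H,
     beta * `|v| ^+ 2 <= affine_form b0 b (const_mx 1) v v <= C * `|v| ^+ 2)
  (m : nat) (l : 'I_m -> {linear H -> R^o})
  (l_continuous : forall j, continuous (l j)) :
  let F := measurement_map b0 b l in
  [/\ smooth_on (pos_orthant R n) F,
      forall s : 'rV[R]_n, pos_orthant R n s ->
        [/\ F s \is symmetricmx, loewner_le 0 (F s) &
            lin_indep_forms l -> posdefmx (F s)],
      (forall s t : 'rV[R]_n, pos_orthant R n s -> (forall i : 'I_n, 0 <= t ord0 i) ->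
        loewner_le (dir_deriv F s t) 0) /\
      (forall s1 s2 : 'rV[R]_n, pos_orthant R n s1 -> pos_orthant R n s2 ->
        (forall i : 'I_n, s1 ord0 i <= s2 ord0 i) -> loewner_le (F s2) (F s1)) &
      (forall s s0 : 'rV[R]_n, pos_orthant R n s -> pos_orthant R n s0 ->
        loewner_le (dir_deriv F s0 (s - s0)) (F s - F s0)) /\
      (forall (s s0 : 'rV[R]_n) (t : R), pos_orthant R n s -> pos_orthant R n s0 ->
        0 <= t <= 1 ->
        loewner_le (F ((1 - t) *: s0 + t *: s))
                   ((1 - t) *: F s0 + t *: F s))].
Proof.
have b1_coercive v : beta * `|v| ^+ 2 <= affine_form b0 b (const_mx 1) v v.
  by have /andP[] := b1_bounds v.
move=> F; pose B s := affine_symform b0 b s.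
pose u s j := var_sol (affine_form b0 b s) (l j).
have B_psd s : pos_orthant R n s -> forall w, 0 <= B s w w.
  exact: affine_form_psd.
have FE s : pos_orthant R n s -> F s = \matrix_(j, k) B s (u s j) (u s k).
  exact: (measurement_mapE b0_bounded b_bounded b0_psd b_psd beta_gt0).
have decr (s t : 'rV[R]_n) : pos_orthant R n s -> (forall i, 0 <= t ord0 i) ->
    loewner_le (dir_deriv F s t) 0.
  move=> Us t0; rewrite /loewner_le sub0r.
  rewrite (dir_deriv_measurement_map b0_bounded b_bounded b0_psd b_psd
    beta_gt0)// opprK; apply: possemidefmx_sum => i; apply: possemidefmxZ => //.
  by apply: possemidefmx_gram; exact: b_psd.
have convex s s0 : pos_orthant R n s -> pos_orthant R n s0 ->
    loewner_le (dir_deriv F s0 (s - s0)) (F s - F s0).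
  move=> Us Us0; rewrite /loewner_le.
  rewrite (measurement_map_energy b0_bounded b_bounded b0_psd b_psd beta_gt0)//.
  by apply: (possemidefmx_gram (a := B s)); exact: B_psd.
split.
- exact: (measurement_map_smooth b0_bounded b_bounded b0_psd b_psd beta_gt0).
- move=> s Us; rewrite FE//; split; first exact: gram_symmetric.
    by rewrite /loewner_le subr0; apply: possemidefmx_gram; exact: B_psd.
  move=> l_free; split=> [|x x_neq0]; first exact: gram_symmetric.
  rewrite gram_quadratic lt_neqAle B_psd// andbT eq_sym.
  (* If the quadratic form vanishes at [x], coercivity gives [w = 0]; then [B s w v], which is the
     combination of the [l j v] with coefficients [x], vanishes for all [v], and independence yields
     [x = 0]. *)
  apply: contra_neq x_neq0 => Bw0; set w := \sum_(j < m) _ in Bw0.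
  have w0 : w = 0.
    have [c c0 Bc] := affine_form_coercive b0_psd b_psd beta_gt0 b1_coercive Us.
    apply/eqP; rewrite -normr_eq0 -sqrf_eq0 eq_le sqr_ge0 andbT.
    by rewrite -(pmulr_rle0 _ c0) (le_trans (Bc w))// -[leLHS]/(B s w w) Bw0.
  apply/colP => j; rewrite mxE; apply: (l_free (fun j => x j ord0)) => v.
  have Bwv : B s w v = 0 by rewrite w0; exact: linear0l.
  rewrite -[RHS]Bwv /w symform_suml.
  apply: eq_bigr => i _; rewrite symformZl; congr (_ * _).
  by rewrite [RHS](affine_solP b0_bounded b_bounded b0_psd b_psd beta_gt0).
- split=> // s1 s2 Us1 Us2 s12; rewrite /loewner_le.
  (* The difference is the convexity remainder at [s2] plus minus the derivative in the nonnegative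
     direction [s2 - s1]; both are positive semidefinite, so no integration along the segment is
     required. *)
  have -> : F s1 - F s2 = F s1 - F s2 - dir_deriv F s2 (s1 - s2) +
      (0 - dir_deriv F s2 (s2 - s1)).
    have -> : s2 - s1 = -1 *: (s1 - s2) by rewrite scaleN1r opprB.
    by rewrite dir_derivZ scaleN1r opprK add0r subrK.
  apply: possemidefmxD; first exact: convex.
  by apply: decr => // i; rewrite !mxE subr_ge0.
- split=> // s s0 t Us Us0 /andP[t0 t1]; set z := _ + _.
  have Uz : pos_orthant R n z.
    move=> i; rewrite !mxE; have := Us i; have := Us0 i.
    (* For [t = 0] the entry is that of [s0]; for [t > 0] the term [t s_i] is already positive. *)
    move: t0; rewrite le_eqVlt => /predU1P[<- s0i _|t0 s0i si].
      by rewrite subr0 mul1r mul0r addr0.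
    by rewrite ltr_wpDl ?mulr_gt0// mulr_ge0 ?subr_ge0// ltW.
  (* Convexity is applied twice with the tangent at [z]; the weighted tangent terms cancel because
     [z] is the weighted mean of [s0] and [s]. *)
  have E : (1 - t) *: dir_deriv F z (s0 - z) + t *: dir_deriv F z (s - z) = 0.
    rewrite -!dir_derivZ -dir_derivD.
    have -> : (1 - t) *: (s0 - z) + t *: (s - z) = 0 *: z.
      by apply/rowP => i; rewrite !mxE; ring.
    by rewrite dir_derivZ scale0r.
  rewrite /loewner_le.
  have -> : (1 - t) *: F s0 + t *: F s - F z =
      (1 - t) *: (F s0 - F z - dir_deriv F z (s0 - z)) +
      t *: (F s - F z - dir_deriv F z (s - z)).
    rewrite !scalerBr addrACA -opprD E subr0.
    by rewrite addrACA -opprD -scalerDl subrK scale1r.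
  by apply: possemidefmxD; apply: possemidefmxZ; rewrite ?subr_ge0//;
    exact: convex.
Qed.
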